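(* For every $r\in\{1,\infty\}$ and every $N\in\{0,2,3,\ldots\}$, the group $\mathbb{G}_r(N)$ is strongly exotic.
   Context: All groups are written additively. A value on a group $G$ is a function $p\colon G\to[0,\infty)$ with $p(x)=0\iff x=0$, $p(-x)=p(x)$, and $p(x+y)\le p(x)+p(y)$ for all $x,y\in G$. A value induces the metric $d_p(x,y)=p(x-y)$, and metric and topological notions for a valued group $(G,p)$ refer to $d_p$. Isometric group homomorphisms, embeddings and isomorphisms are group homomorphisms, embeddings and isomorphisms preserving the values. A valued Abelian group $(G,p)$ is of class $\mathcal{O}_0$ if $\lim_{n\to\infty}p(nx)/n=0$ for every $x\in G$. Let $\mathfrak{G}_\infty(0)$ be the class of all separable valued Abelian groups of class $\mathcal{O}_0$, and $\mathfrak{G}_1(0)$ the subclass of those $(G,p)$ with $p\le 1$. For $N\ge 2$, let $\mathfrak{G}_\infty(N)$ be the subclass of $\mathfrak{G}_\infty(0)$ of groups of exponent dividing $N$ (i.e. $Nx=0$ for all $x$), and $\mathfrak{G}_1(N)=\mathfrak{G}_\infty(N)\cap\mathfrak{G}_1(0)$. For $r\in\{1,\infty\}$ and $N\in\{0,2,3,\ldots\}$, $\mathbb{G}_r(N)$ denotes the valued Abelian group which is unique, up to isometric group isomorphism, with the following properties (its existence and uniqueness is a theorem of Niemiec): (1) $\mathbb{G}_r(N)$ is complete and belongs to $\mathfrak{G}_r(N)$; (2) every finite valued group in $\mathfrak{G}_r(N)$ admits an isometric group embedding into $\mathbb{G}_r(N)$; (3) every isometric group homomorphism between two finite subgroups of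 $\mathbb{G}_r(N)$ extends to an isometric group homomorphism of $\mathbb{G}_r(N)$ onto itself; (4) if $N=0$, the elements of finite order form a dense subgroup of $\mathbb{G}_r(N)$. A Polish group $G$ is strongly exotic if every weakly continuous representation of $G$ on a Hilbert space is trivial, that is, if for every Hilbert space $H$, every continuous group homomorphism from $G$ to the group $\mathrm{GL}(H)$ of bounded invertible linear operators on $H$, equipped with the weak operator topology, is constant. *)

(* Defs.v *)
From HB Require Import structures.
From mathcomp Require Import all_boot all_order all_algebra.
From mathcomp Require Import sesquilinear complex.
From mathcomp Require Import all_classical all_reals all_analysis.
Set Implicit Arguments.
Unset Strict Implicit.
Unset Printing Implicit Defensive.
Import Order.TTheory GRing.Theory Num.Theory.
Import numFieldNormedType.Exports.
Local Open Scope classical_set_scope.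
Local Open Scope ring_scope.

HB.mixin Record isValued (R : realType) G & GRing.Zmodule G := {
  value : G -> R;
  value_ge0 : forall x, 0 <= value x;
  value_eq0 : forall x, value x = 0 <-> x = 0;
  valueN : forall x, value (- x) = value x;
  valueD : forall x y, value (x + y) <= value x + value y
}.

#[short(type="valuedZmodType")]
HB.structure Definition ValuedZmodule (R : realType) :=
  {G of GRing.Zmodule G & isValued R G}.

(* Every valued group carries the metric induced by its value, and the
   corresponding topology and uniformity. *)
Section ValuedMetric.
Context {R : realType} {G : valuedZmodType R}.

Let dist (x y : G) : R := value (x - y).

Let distxx x : dist x x = 0.
Proof. by apply/value_eq0; rewrite subrr. Qed.

Let dist_pos x y : dist x y = 0 -> x = y.
Proof. by move/value_eq0/eqP; rewrite subr_eq0 => /eqP. Qed.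

Let dist_sym x y : dist x y = dist y x.
Proof. by rewrite /dist -valueN opprB. Qed.

Let dist_triangle y x z : dist x z <= dist x y + dist y z.
Proof. by rewrite /dist -(subrKA y) valueD. Qed.

#[non_forgetful_inheritance]
HB.instance Definition _ :=
  @isMetric.Build R (ValuedZmodule.sort G)
    dist distxx dist_pos dist_sym dist_triangle.

Lemma mdist_value (x y : G) : mdist x y = value (x - y).
Proof. by []. Qed.

Let sub_cont : continuous (fun x : G * G => x.1 - x.2).
Proof.
move=> [a b]; apply/metricType_numDomainType.cvgrPdist_lt => e e0.
have e2 : 0 < e / 2 by rewrite divr_gt0.
exists (ball a (e / 2), ball b (e / 2)).
  by split; exact: nbhsx_ballx.
move=> [c d] /= [ac bd].
have -> : mdist (a - b) (c - d) = value ((a - c) + (d - b)).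
  by rewrite mdist_value opprB addrC addrACA [d + a]addrC addrACA.
move: ac bd; rewrite !ballEmdist /= !mdist_value => ac bd.
rewrite -[value (b - d)]valueN opprB in bd.
rewrite (splitr e).
by apply: le_lt_trans (valueD _ _) _; apply: ltrD.
Qed.

#[non_forgetful_inheritance]
HB.instance Definition _ :=
  PreTopologicalNmodule_isTopologicalZmodule.Build (ValuedZmodule.sort G)
    sub_cont.

End ValuedMetric.

Definition separable_space (T : topologicalType) : Prop :=
  exists2 D : set T, countable D & dense D.

Definition complete_space (T : uniformType) : Prop :=
  forall F : set_system T, ProperFilter F -> cauchy F -> exists x : T, F --> x.

Section NiemiecGroups.
Context {R : realType}.

Definition classO0 (G : valuedZmodType R) : Prop :=
  forall x : G, value (x *+ n) / n%:R @[n --> \oo] --> (0 : R).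

(* Membership in the class G_r(N), with r = 1 or r = +oo; for r = +oo the bound
   on the values is void, and so is the condition on the exponent for N = 0. *)
Definition in_classG (r : \bar R) (N : nat) (G : valuedZmodType R) : Prop :=
  [/\ separable_space G,
      classO0 G,
      forall x : G, ((value x)%:E <= r)%E &
      forall x : G, x *+ N = 0].

Definition isometric (F G : valuedZmodType R) (f : F -> G) : Prop :=
  forall x : F, value (f x) = value x.

(* An isometric homomorphism is injective, so it is an embedding. *)
Definition embeds_finite_groups (r : \bar R) (N : nat)
    (G : valuedZmodType R) : Prop :=
  forall F : valuedZmodType R, finite_set [set: F] -> in_classG r N F ->
  exists f : {additive F -> G}, isometric f.

Definition finite_subgroup (G : zmodType) (A : set G) : Prop :=
  finite_set A /\ zmod_closed [in A].

(* Only the restriction of f to A is relevant. *)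
Definition finitely_homogeneous (G : valuedZmodType R) : Prop :=
  forall (A B : set G) (f : G -> G),
    finite_subgroup A -> finite_subgroup B ->
    set_fun A B f ->
    {in A &, {morph f : x y / x + y}} ->
    {in A, forall x, value (f x) = value x} ->
  exists g : {additive G -> G},
    [/\ isometric g, set_surj setT setT g & {in A, g =1 f}].

Definition torsion (G : zmodType) : set G :=
  [set x | exists2 n : nat, (0 < n)%N & x *+ n = 0].

(* The properties which determine the group G_r(N) up to isometric group
   isomorphism. *)
Record isG (r : \bar R) (N : nat) (G : valuedZmodType R) : Prop := {
  isG_complete : complete_space G;
  isG_class : in_classG r N G;
  isG_embeds : embeds_finite_groups r N G;
  isG_homogeneous : finitely_homogeneous G;
  isG_dense_torsion : N = 0%N -> dense (@torsion G)
}.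

End NiemiecGroups.

(* Complex Hilbert spaces; the inner product is linear in its first argument
   and conjugate-linear in the second one. *)
HB.mixin Record CompleteNormedModule_isHilbert (R : realType) H
    & CompleteNormedModule R[i] H := {
  inner : {dot H for (@Num.conj R[i])};
  inner_norm : forall x : H, inner x x = `|x| ^+ 2
}.

#[short(type="hilbertType")]
HB.structure Definition Hilbert (R : realType) :=
  {H of CompleteNormedModule R[i] H & CompleteNormedModule_isHilbert R H}.

(* The set of maps H -> H with the coarsest topology that makes all the
   functions T |-> <T x, y> continuous; it induces on the operators the weak
   operator topology. *)
Definition wot (R : realType) (H : hilbertType R) : Type :=
  sup_topology (fun xy : H * H => Topological.on
    (initial_topology (fun T : H -> H => inner (T xy.1) xy.2 : R[i]^o))).

HB.instance Definition _ (R : realType) (H : hilbertType R) := Topological.on (wot H).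

Definition bounded_operator (R : realType) (H : hilbertType R) (T : H -> H) : Prop :=
  linear T /\ bounded_near T (nbhs (0 : H)).

Definition GL (R : realType) (H : hilbertType R) : set (wot H) :=
  [set T | bounded_operator T /\
     exists S : H -> H, [/\ bounded_operator S, cancel T S & cancel S T]].

Arguments GL {R} H.

Definition GL_fun (R : realType) (H : hilbertType R) (T : GL H) : H -> H := set_val T.

(* GL H has the subspace topology. The notion is meant for Polish groups, but
   Polishness plays no role in the condition itself; complete separable valued
   groups, such as those with isG, are Polish. *)
Definition strongly_exotic (R : realType) (G : topologicalZmodType) : Prop :=
  forall (H : hilbertType R) (pi : G -> GL H),
    continuous pi ->
    (forall g h, GL_fun (pi (g + h)) = GL_fun (pi g) \o GL_fun (pi h)) ->
  forall g h, pi g = pi h.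

Arguments strongly_exotic : clear implicits.

(* Main.v *)
Require Import Defs.
From HB Require Import structures.
From mathcomp Require Import all_boot all_order all_algebra.
From mathcomp Require Import sesquilinear complex.
From mathcomp Require Import all_classical all_reals all_analysis.
From mathcomp Require Import ring lra zify.
Set Implicit Arguments.
Unset Strict Implicit.
Unset Printing Implicit Defensive.
Import Order.TTheory GRing.Theory Num.Theory.
Import numFieldNormedType.Exports.
Local Open Scope classical_set_scope.
Local Open Scope ring_scope.

(** The crux is an averaging argument on finite subgroups of [G] that carry a
    pathological submeasure.

    Local boundedness and strong continuity.  A weakly continuous homomorphism
    into [GL H] is norm bounded near [0]: the operator norm is lower
    semicontinuous along it, so Baire's argument in the complete group [G]
    applies ([rep_locally_bounded]).  It is moreover strongly continuous at [0]
    ([rep_strongly_continuous]): near a point where [|rho g v|] almost attains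
    its local supremum, weak closeness of [rho h v] to [rho g v] forces norm
    closeness.

    Finite subgroups.  Let [A] be a finite subgroup of [G] with values at most
    [D], and let [d > 0].  Let the points be the subsets of size at least [K] of
    a set with [2K] elements; each point lies in at least half of the [2K]
    blocks [{s | j \in s}], but [K] blocks never cover all points.  Hence, for
    [K] large, the power of [A] indexed by the points carries a value which
    extends that of the diagonal copy of [A], is bounded by [D], and is at most
    [d] on every function supported in one block.  By the embedding property and
    finite homogeneity this power embeds into [G] over [A] ([cube_extension]).

    Averaging.  Suppose a finite abelian group acts on [H] by operators bounded
    by [C].  Averaging the inner product makes the action unitary, so the
    averages over subgroups become commuting orthogonal projections, and a
    telescoping orthogonal decomposition shows that a vector almost fixed by
    subgroups [K_j] covering each generating subgroup [L_i] for at least half of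
    the [j] is almost fixed by the whole group ([avsqn_covering],
    [almost_fixed]).  In the power of [A] the [K_j] are the functions supported
    in one block, which by strong continuity almost fix any given vector once [d]
    is small.  The bound obtained does not depend on [K], so letting [d] tend to
    [0] shows that [A] acts trivially when [D] is within the radius of local
    boundedness ([small_rep_trivial]).

    Conclusion.  For arbitrary [D], the same power with [d] below that radius
    writes the elements of [A] as sums of elements of subgroups of values at most
    [d], so [A] acts trivially ([finite_rep_trivial]).  Torsion elements generate
    finite subgroups and are dense, and strong continuity extends triviality to
    [G]. *)

(** * The real part of the inner product *)

Section RealDot.
Context {R : realType} {H : hilbertType R}.
Implicit Types u v w : H.

(** Only real parts enter the estimates, so that they all take place in the
    ordered field [R]. *)
Definition rdot u w : R := complex.Re (inner u w).

Definition sqn u : R := rdot u u.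

Lemma rdotDl u v w : rdot (u + v) w = rdot u w + rdot v w.
Proof. by rewrite /rdot linearDl raddfD. Qed.

Lemma rdotC u w : rdot u w = rdot w u.
Proof.
rewrite /rdot hermC expr0 mul1r.
have E (z : R[i]) : complex.Re (Num.conj z) = complex.Re z.
  by apply: complexI; rewrite !complexRe Re_conj.
exact: E.
Qed.

Lemma rdotDr u v w : rdot w (u + v) = rdot w u + rdot w v.
Proof. by rewrite rdotC rdotDl !(rdotC w). Qed.

Lemma rdotNl u w : rdot (- u) w = - rdot u w.
Proof. by rewrite /rdot linearNl raddfN. Qed.

Lemma rdotNr u w : rdot w (- u) = - rdot w u.
Proof. by rewrite rdotC rdotNl rdotC. Qed.

Lemma rdot0l w : rdot 0 w = 0.
Proof. by rewrite /rdot linear0l raddf0. Qed.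

Lemma rdot_suml (I : finType) (P : pred I) (f : I -> H) w :
  rdot (\sum_(i | P i) f i) w = \sum_(i | P i) rdot (f i) w.
Proof.
exact: (big_morph (rdot^~ w) (fun u v => rdotDl u v w) (rdot0l w)).
Qed.

Lemma rdotVn n u w : rdot ((n%:R : R[i])^-1 *: u) w = n%:R^-1 * rdot u w.
Proof.
rewrite /rdot linearZl_LR /= -(rmorph_nat (real_complex R)) -fmorphV.
by case: (inner u w) => a b /=; rewrite mul0r subr0.
Qed.

Lemma sqnE u : (sqn u)%:C%C = `|u| ^+ 2.
Proof.
by rewrite /sqn /rdot inner_norm RRe_real // rpredX // normr_real.
Qed.

Lemma sqn_ge0 u : 0 <= sqn u.
Proof. by rewrite -ler0c sqnE exprn_ge0. Qed.

Lemma sqn_eq0 u : sqn u = 0 -> u = 0.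
Proof.
move=> u0; have /esym/eqP := sqnE u.
by rewrite u0 rmorph0 expf_eq0 normr_eq0 => /eqP.
Qed.

Lemma sqnN u : sqn (- u) = sqn u.
Proof. by rewrite /sqn rdotNl rdotNr opprK. Qed.

Lemma sqnD u w : sqn (u + w) = sqn u + sqn w + 2 * rdot u w.
Proof. by rewrite /sqn rdotDl !rdotDr (rdotC w u); ring. Qed.

Lemma sqnB u w : sqn (u - w) = sqn u + sqn w - 2 * rdot u w.
Proof. by rewrite sqnD sqnN rdotNr; ring. Qed.

Lemma sqnB_le u w : sqn (u - w) <= 2 * sqn u + 2 * sqn w.
Proof. by have := sqn_ge0 (u + w); rewrite sqnB sqnD; lra. Qed.

Lemma rdot_le_sqn u w : 2 * rdot u w - sqn w <= sqn u.
Proof. by have := sqn_ge0 (u - w); rewrite sqnB; lra. Qed.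

(** Convexity of the squared norm: the squared distances from the mean to the
    given vectors sum to a nonnegative number. *)
Lemma sqn_mean (I : finType) (P : {set I}) (f : I -> H) (e : R) : (0 < #|P|)%N ->
  (forall i, i \in P -> sqn (f i) <= e) ->
  sqn ((#|P|%:R : R[i])^-1 *: \sum_(i in P) f i) <= e.
Proof.
move=> P0 fe; set m := _ *: _.
have n0 : 0 < #|P|%:R :> R by rewrite ltr0n.
have sm : \sum_(i in P) rdot (f i) m = #|P|%:R * sqn m.
  rewrite -rdot_suml /sqn {2}/m rdotVn mulrA mulfV ?mul1r //.
  by rewrite gt_eqF.
have : 0 <= \sum_(i in P) (e + sqn m - 2 * rdot (f i) m).
  apply: sumr_ge0 => i iP; apply: le_trans (sqn_ge0 (f i - m)) _.
  by rewrite sqnB; have := fe i iP; lra.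
rewrite sumrB -mulr_sumr sm sumr_const -mulr_natl => h.
have : 0 <= #|P|%:R * (e - sqn m) by move: h; lra.
by rewrite pmulr_rge0 // subr_ge0.
Qed.

End RealDot.

(** * Averaging over subgroups of a finite abelian group *)

Section FiniteAction.
Context {R : realType} {H : hilbertType R} {F : finZmodType}.
Variable rho : F -> H -> H.
Hypothesis rho_linear : forall a, linear (rho a).
Hypothesis rhoD : forall a b w, rho (a + b) w = rho a (rho b w).
Hypothesis rho0 : forall w, rho 0 w = w.

HB.instance Definition _ a := GRing.isLinear.Build R[i] H H _ (rho a) (rho_linear a).

(** The inner product averaged over the action, up to the factor [#|F|]; the
    action is unitary for it. *)
Definition avdot (u w : H) : R := \sum_a rdot (rho a u) (rho a w).
Definition avsqn u := avdot u u.

Lemma avdotC u w : avdot u w = avdot w u.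
Proof. by apply: eq_bigr => a _; rewrite rdotC. Qed.
Lemma avsqn_ge0 u : 0 <= avsqn u.
Proof. by apply: sumr_ge0 => a _; exact: sqn_ge0. Qed.
Lemma avdotDl u v w : avdot (u + v) w = avdot u w + avdot v w.
Proof. by rewrite -big_split; apply: eq_bigr => a _; rewrite linearD rdotDl. Qed.
Lemma avdotDr u v w : avdot w (u + v) = avdot w u + avdot w v.
Proof. by rewrite avdotC avdotDl !(avdotC w). Qed.
Lemma avdotNl u w : avdot (- u) w = - avdot u w.
Proof. by rewrite -sumrN; apply: eq_bigr => a _; rewrite linearN rdotNl. Qed.
Lemma avdotVn n u w : avdot ((n%:R : R[i])^-1 *: u) w = n%:R^-1 * avdot u w.
Proof. by rewrite mulr_sumr; apply: eq_bigr => a _; rewrite linearZ rdotVn. Qed.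
Lemma avdot0l w : avdot 0 w = 0.
Proof. by apply: big1 => a _; rewrite linear0 rdot0l. Qed.
Lemma avdot_suml (I : finType) (P : pred I) (f : I -> H) w :
  avdot (\sum_(i | P i) f i) w = \sum_(i | P i) avdot (f i) w.
Proof.
exact: (big_morph (avdot^~ w) (fun u v => avdotDl u v w) (avdot0l w)).
Qed.

Lemma avdot_rho b u w : avdot (rho b u) (rho b w) = avdot u w.
Proof.
rewrite [RHS](reindex_inj (addIr b)) /=.
by apply: eq_bigr => a _; rewrite !rhoD.
Qed.

Implicit Types K L : {set F}.

Definition fixedv K u := forall a, a \in K -> rho a u = u.

Definition avg K u := ((#|K|%:R : R[i])^-1 *: \sum_(a in K) rho a u).

Lemma zmod_closed_card (T : numDomainType) K : zmod_closed K -> #|K|%:R != 0 :> T.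
Proof.
by case=> K0 _; rewrite pnatr_eq0 -lt0n; apply/card_gt0P; exists 0.
Qed.

Lemma avg_is_linear K : linear (avg K).
Proof.
move=> c u w; rewrite /avg scalerA mulrC -scalerA -scalerDr; congr (_ *: _).
rewrite scaler_sumr -big_split; apply: eq_bigr => a _.
by rewrite linearP.
Qed.

HB.instance Definition _ K := GRing.isLinear.Build R[i] H H _ (avg K) (avg_is_linear K).

Lemma fixedv_avg K w : zmod_closed K -> fixedv K (avg K w).
Proof.
case=> K0 KB b bK; rewrite /avg linearZ; congr (_ *: _).
rewrite linear_sum [RHS](reindex_inj (addrI b)) /=.
apply: eq_big => [a|a _]; last by rewrite rhoD.
apply/idP/idP => [aK|baK].
  by rewrite -[a]opprK KB // -sub0r KB.
by rewrite -[a](addrK b) addrC (addrC a) -[_ + _](addrC (b + a)) KB.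
Qed.

Lemma avg_fixedv K w : zmod_closed K -> fixedv K w -> avg K w = w.
Proof.
move=> Kc Kw; rewrite /avg (eq_bigr (fun=> w)) // sumr_const.
by rewrite -[w *+ _]scaler_nat scalerA mulVf ?scale1r // zmod_closed_card.
Qed.

Lemma fixedvS K L w : K \subset L -> fixedv L w -> fixedv K w.
Proof. by move=> /fintype.subsetP KL Lw a /KL /Lw. Qed.

Lemma rho_avg b K w : rho b (avg K w) = avg K (rho b w).
Proof.
rewrite /avg linearZ linear_sum; congr (_ *: _); apply: eq_bigr => a _.
by rewrite -!rhoD addrC.
Qed.

Lemma fixedv_avgr K L w : fixedv K w -> fixedv K (avg L w).
Proof. by move=> Kw a aK; rewrite rho_avg Kw. Qed.

Lemma avgC K L w : avg K (avg L w) = avg L (avg K w).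
Proof.
rewrite [avg L w]/avg linearZ linear_sum [RHS]/avg; congr (_ *: _).
by apply: eq_bigr => a _; rewrite rho_avg.
Qed.

(** [avg K] is self-adjoint for the averaged inner product, tested here against
    the vectors of its range. *)
Lemma avdot_avgl K u w : fixedv K w -> zmod_closed K ->
  avdot (avg K u) w = avdot u w.
Proof.
move=> Kw Kc; rewrite avdotVn avdot_suml (eq_bigr (fun=> avdot u w)).
  rewrite sumr_const -[avdot u w *+ _]mulr_natl mulrA mulVf ?mul1r //.
  exact: zmod_closed_card.
by move=> a aK; rewrite -{1}(Kw a aK) avdot_rho.
Qed.

(** Pythagoras for the orthogonal projection [avg K]. *)
Lemma avsqn_avg K w : zmod_closed K ->
  avsqn w = avsqn (avg K w) + avsqn (w - avg K w).
Proof.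
move=> Kc; have := avdot_avgl (w := avg K w) w (fixedv_avg w Kc) Kc.
set m := avg K w => mE.
have o : avdot (w - m) m = 0 by rewrite avdotDl avdotNl mE subrr.
rewrite -{1}(subrK m w) /avsqn; move: (w - m) o => y o.
by rewrite avdotDl !avdotDr (avdotC m) o; ring.
Qed.

(** With [P_i] the projection [avg (L i)] and [s = i_1, ..., i_n], this is the
    sum over [k] of [phi i_k] times the averaged square norm of
    [(1 - P_{i_k}) P_{i_(k-1)} ... P_{i_1} w].  For constant weight [1] the
    terms are those of an orthogonal decomposition of
    [w - P_{i_n} ... P_{i_1} w]. *)
Fixpoint chain (I : Type) (L : I -> {set F}) (phi : I -> nat) (s : seq I) (w : H) : R :=
  if s is i :: s' then
    avsqn (w - avg (L i) w) *+ phi i + chain L phi s' (avg (L i) w)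
  else 0.

Section Chain.
Variables (I : Type) (L : I -> {set F}).
Hypothesis Lc : forall i, zmod_closed (L i).

Lemma chain_le phi s w : (forall i, (phi i <= 1)%N) -> chain L phi s w <= avsqn w.
Proof.
move=> phi1; elim: s w => [|i s IH] w /=; first exact: avsqn_ge0.
rewrite (avsqn_avg w (Lc i)) addrC lerD //.
by rewrite -[leRHS]mulr1n; apply: ler_wpMn2l; first exact: avsqn_ge0.
Qed.

Definition iavg s w := foldl (fun u i => avg (L i) u) w s.

Lemma chain_iavg s w : chain L (fun=> 1%N) s w + avsqn (iavg s w) = avsqn w.
Proof.
elim: s w => [|i s IH] w /=; first by rewrite add0r.
by rewrite -addrA IH mulr1n addrC -avsqn_avg.
Qed.

(** If [L i] is contained in [K] then [1 - P_i] annihilates the range of [avg K];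
    the weight discards the other indices. *)
Lemma chain_subavg K s w : zmod_closed K ->
  chain L (fun i => nat_of_bool (L i \subset K)) s (w - avg K w) =
  chain L (fun i => nat_of_bool (L i \subset K)) s w.
Proof.
move=> Kc; elim: s w => [|i s IH] w //=.
rewrite linearB /= (avgC (L i) K) IH; congr (_ + _).
case: (boolP (L i \subset K)) => LK; rewrite ?mulr0n // !mulr1n.
have -> : avg K (avg (L i) w) = avg K w.
  rewrite -avgC avg_fixedv //; exact: fixedvS LK (fixedv_avg w Kc).
by rewrite opprB addrA subrK.
Qed.

Lemma chain_sum (J : finType) (phi : J -> I -> nat) s w k :
  (forall i, (k <= \sum_j phi j i)%N) ->
  chain L (fun=> 1%N) s w *+ k <= \sum_j chain L (phi j) s w.
Proof.
move=> kphi; elim: s w => [|i s IH] w /=.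
  by rewrite mul0rn big1.
rewrite mulrnDl big_split /= lerD // -mulrnA mul1n sumrMnr.
by apply: ler_wpMn2l; first exact: avsqn_ge0.
Qed.

Lemma fixedv_iavg i s w : fixedv (L i) w -> fixedv (L i) (iavg s w).
Proof.
by elim: s w => [|j s IH] w //= iw; apply: IH; exact: fixedv_avgr.
Qed.

Lemma avg_iavg K s w : avg K (iavg s w) = iavg s (avg K w).
Proof. by elim: s w => [|j s IH] w //=; rewrite IH avgC. Qed.
End Chain.

Lemma fixedv_iavg_in (I : eqType) (L : I -> {set F}) i s w :
  (forall i, zmod_closed (L i)) -> i \in s -> fixedv (L i) (iavg L s w).
Proof.
move=> Lc; elim: s w => [|j s IH] w //=; rewrite inE => /orP[/eqP ->|/IH//].
by apply: fixedv_iavg; exact: fixedv_avg.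
Qed.

(** Replacing [w] by [z := w - avg F w] makes the decomposition along the [L i]
    exhaust [z].  For each [j] the part of it indexed by the [L i] inside [K j]
    only sees [w - avg (K j) w], and summing over [j] counts every index at
    least [k] times. *)
Lemma avsqn_covering (I J : finType) (L : I -> {set F}) (K : J -> {set F}) k w :
  (forall i, zmod_closed (L i)) -> (forall j, zmod_closed (K j)) ->
  (forall u, (forall i, fixedv (L i) u) -> fixedv [set: F]%SET u) ->
  (forall i, (k <= #|[pred j | L i \subset K j]|)%N) ->
  avsqn (w - avg [set: F]%SET w) *+ k <= \sum_j avsqn (w - avg (K j) w).
Proof.
move=> Lc Kc gen kLK.
have Fc : zmod_closed [set: F]%SET by split=> [|a b]; rewrite !inE.
set z := w - avg [set: F]%SET w.
have z0 : avg [set: F]%SET z = 0.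
  by rewrite /z linearB /= (avg_fixedv Fc (fixedv_avg w Fc)) subrr.
have e0 : iavg L (enum I) z = 0.
  have Fe : fixedv [set: F]%SET (iavg L (enum I) z).
    by apply: gen => i; apply: fixedv_iavg_in => //; rewrite mem_enum.
  rewrite -(avg_fixedv Fc Fe) avg_iavg z0.
  by elim: (enum I) => //= i s IH; rewrite linear0.
have <- : chain L (fun=> 1%N) (enum I) z = avsqn z.
  by rewrite -(chain_iavg Lc (enum I) z) e0 /avsqn avdot0l addr0.
apply: le_trans (chain_sum L (enum I) z
  (phi := fun j i => nat_of_bool (L i \subset K j)) _) _.
  move=> i; apply: leq_trans (kLK i) _; rewrite -sum1_card big_mkcond /=.
  by apply: leq_sum => j _; rewrite inE; case: (_ \subset _).
apply: ler_sum => j _.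
rewrite -(chain_subavg Lc _ _ (Kc j)).
have -> : z - avg (K j) z = w - avg (K j) w.
  rewrite /z linearB /= (@avg_fixedv _ (avg [set: F]%SET w)) //.
    by rewrite opprB addrA subrK.
  apply: fixedvS (fixedv_avg w Fc); exact: finset.subsetT.
by apply: chain_le => // i; case: (_ \subset _).
Qed.

(** Transfers [avsqn_covering] to the original norm, to which the averaged one is
    equivalent with constants depending only on the uniform bound [C].  That the
    final bound involves neither [F] nor the index sets is what makes it
    useful. *)
Lemma almost_fixed (I J : finType) (L : I -> {set F}) (K : J -> {set F})
    k (C e : R) v :
  (0 < k)%N -> 0 < C -> 0 <= e ->
  (forall i, zmod_closed (L i)) -> (forall j, zmod_closed (K j)) ->
  (forall u, (forall i, fixedv (L i) u) -> fixedv [set: F]%SET u) ->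
  (forall i, (k <= #|[pred j | L i \subset K j]|)%N) -> (#|J| <= k.*2)%N ->
  (forall a w, sqn (rho a w) <= C * sqn w) ->
  (forall j a, a \in K j -> sqn (rho a v - v) <= e) ->
  forall a, sqn (rho a v - v) <= 4 * (C + 1) * C ^+ 2 * e.
Proof.
move=> k0 C0 e0 Lc Kc gen kLK Jk rhoC rhoe a.
have Fc : zmod_closed [set: F]%SET by split=> [|x y]; rewrite !inE.
have n0 : 0 < #|F|%:R :> R.
  by rewrite ltr0n; apply/card_gt0P; exists 0.
set z := v - avg [set: F]%SET v.
have az : rho a v - v = rho a z - z.
  rewrite /z linearB /= (fixedv_avg v Fc) ?inE //.
  by rewrite opprB addrA subrK.
(* [C] bounds all operators, hence also their inverses: [avsqn] is comparable
   to [#|F|] times [sqn], with constants [C] and [1 / C]. *)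
have sumF (x : R) : #|F|%:R * x = \sum_(b : F) x by rewrite sumr_const mulr_natl.
have up w : avsqn w <= #|F|%:R * (C * sqn w).
  by rewrite sumF; apply: ler_sum => b _; exact: rhoC.
have low w : #|F|%:R * sqn w <= C * avsqn w.
  rewrite sumF mulr_sumr; apply: ler_sum => b _.
  by rewrite -{1}(rho0 w) -(addNr b) rhoD; exact: rhoC.
have hj j : avsqn (v - avg (K j) v) <= #|F|%:R * (C * e).
  apply: le_trans (up _) _.
  apply: ler_wpM2l; first exact: ltW.
  apply: ler_wpM2l; first exact: ltW.
  have [K0 _] := Kc j.
  have -> : v - avg (K j) v =
      (#|K j|%:R : R[i])^-1 *: \sum_(b in K j) (v - rho b v).
    rewrite sumrB sumr_const scalerBr -[v *+ _]scaler_nat scalerA mulVf ?scale1r //.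
    exact: zmod_closed_card.
  apply: sqn_mean; first by apply/card_gt0P; exists 0.
  by move=> b bK; rewrite -sqnN opprB; exact: rhoe bK.
have hz : avsqn z *+ k <= \sum_(j : J) #|F|%:R * (C * e).
  apply: le_trans (avsqn_covering v Lc Kc gen kLK) _.
  by apply: ler_sum => j _; exact: hj.
have X0 : 0 <= #|F|%:R * (C * e) by rewrite !mulr_ge0 // ltW.
have hz2 : avsqn z <= 2 * (#|F|%:R * (C * e)).
  rewrite sumr_const in hz.
  rewrite -(@ler_pMn2r _ k) //; apply: le_trans hz _.
  have -> x : 2 * x *+ k = x *+ k.*2 :> R by rewrite -mul2n mulrnA mulr_natl.
  exact: ler_wpMn2l.
have sz : sqn z <= 2 * (C ^+ 2 * e).
  rewrite -(ler_pM2l n0); apply: le_trans (low z) _.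
  apply: le_trans (ler_wpM2l (ltW C0) hz2) _.
  by rewrite le_eqVlt; apply/orP; left; apply/eqP; ring.
rewrite az; apply: le_trans (sqnB_le _ _) _.
have := rhoC a z; have : C * sqn z <= C * (2 * (C ^+ 2 * e)) by rewrite ler_pM2l.
lra.
Qed.

End FiniteAction.

(** * Weakly continuous representations of complete valued groups *)

Section WeakRep.
Context {R : realType} {H : hilbertType R} {G : valuedZmodType R}.
Variable rho : G -> H -> H.

Record weak_rep : Prop := {
  rep_linear : forall g, linear (rho g);
  repD : forall g h u, rho (g + h) u = rho g (rho h u);
  rep0 : forall u, rho 0 u = u;
  rep_bounded : forall g, exists C : R, forall u, sqn (rho g u) <= C * sqn u;
  rep_weak : forall g u w (e : R), 0 < e -> exists2 d : R, 0 < d &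
    forall h, value (h - g) < d ->
      `|rdot (rho h u) w - rdot (rho g u) w| < e
}.

Hypothesis rhoP : weak_rep.

Definition rep_bound (M : R) g := forall u, sqn (rho g u) <= M * sqn u.

Lemma rep_bound_le M M' g : M <= M' -> rep_bound M g -> rep_bound M' g.
Proof.
by move=> MM' b u; apply: le_trans (b u) _; rewrite ler_wpM2r // sqn_ge0.
Qed.

Lemma rep_bound_gt0 g : exists2 C : R, 0 < C & rep_bound C g.
Proof.
have [C bC] := rep_bounded rhoP g.
exists (`|C| + 1); first by have := normr_ge0 C; lra.
by apply: rep_bound_le bC; have := ler_norm C; lra.
Qed.

Lemma rep_bound_split g h C M :
  0 <= C -> rep_bound C g -> rep_bound M h -> rep_bound (C * M) (g + h).
Proof.
move=> C0 bC bM u; rewrite (repD rhoP) -mulrA; apply: le_trans (bC _) _.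
by rewrite ler_wpM2l.
Qed.

(** The operator norm is lower semicontinuous: if [M * sqn u < sqn (rho g u)],
    testing [rho h u] against [rho g u] gives the same for [h] close to [g]. *)
Lemma rep_unbounded_open g M : ~ rep_bound M g ->
  exists2 d : R, 0 < d & forall h, value (h - g) < d -> ~ rep_bound M h.
Proof.
move=> /existsNP[u /negP]; rewrite -ltNge -subr_gt0 => e0.
have [|d d0 dP] := rep_weak rhoP g u (rho g u) (e := (sqn (rho g u) - M * sqn u) / 2).
  by rewrite divr_gt0.
exists d => // h /dP; rewrite ltr_norml => /andP[+ _] bh.
have := bh u; have := rdot_le_sqn (rho h u) (rho g u).
rewrite -/(sqn (rho g u)) => h1 h2 h3; lra.
Qed.

(** One step of Baire's construction; unboundedness near [0] is transported to
    [g] by the invertible operator [rho g]. *)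
Lemma unbounded_shrink g (d M : R) : 0 < d ->
  (forall c C : R, 0 < c -> exists2 h, value h < c & ~ rep_bound C h) ->
  exists g' d' : _, [/\ 0 < d', d' <= d / 2, value (g' - g) <= d / 2 &
    forall h, value (h - g') <= d' -> ~ rep_bound M h].
Proof.
move=> d0 unb; have [C C0 bC] := rep_bound_gt0 (- g).
have [|h hd hM] := unb (d / 2) (C * M); first by rewrite divr_gt0.
have [|c c0 cP] := @rep_unbounded_open (g + h) M.
  move=> b; apply: hM; rewrite -(addKr g h).
  by apply: rep_bound_split => //; exact: ltW.
exists (g + h), (Num.min (d / 2) (c / 2)); split.
- by rewrite lt_min !divr_gt0.
- by rewrite ge_min lexx.
- by rewrite addrAC subrr add0r ltW.
- move=> k kc; apply: cP; apply: le_lt_trans kc _.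
  by rewrite gt_min; apply/orP; right; lra.
Qed.

Lemma value_sub_le (x y z : G) (a b : R) :
  value (x - y) <= a -> value (y - z) <= b -> value (x - z) <= a + b.
Proof.
move=> xy yz; rewrite -(subrKA y); apply: le_trans (valueD _ _) _.
exact: lerD.
Qed.

(** If the representation were unbounded near [0], a nested sequence of balls on
    the [n]-th of which [n] is no bound would shrink to a point whose operator
    is unbounded. *)
Lemma rep_locally_bounded : complete_space G ->
  exists d C : R, [/\ 0 < d, 0 < C & forall g, value g < d -> rep_bound C g].
Proof.
move=> Gc; apply: contrapT => nb.
have unb (c C : R) : 0 < c -> exists2 h, value h < c & ~ rep_bound C h.
  move=> c0; apply: contrapT => nh; apply: nb; exists c, (`|C| + 1).
  split=> //.
  move=> g gc; apply: contrapT => ng; apply: nh; exists g => // b; apply: ng.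
  by apply: rep_bound_le b; have := ler_norm C; lra.
pose P (n : nat) (x y : G * {posnum R}) :=
  [/\ y.2%:num <= x.2%:num / 2, value (y.1 - x.1) <= x.2%:num / 2 &
    forall h, value (h - y.1) <= y.2%:num -> ~ rep_bound n%:R h].
have step (a : nat * (G * {posnum R})) : exists b, P a.1 a.2 b.
  case: a => n [g d].
  have [g' [d' [d'0 dd' gg' hP]]] := unbounded_shrink g n%:R (gt0 d) unb.
  by exists (g', PosNum d'0); split.
have [f fP] := choice step.
pose fix a n := if n is p.+1 then f (p, a p) else (0, PosNum ltr01) : G * {posnum R}.
have aP n : P n (a n) (a n.+1) by exact: fP (n, a n).
have nest m n : (n <= m)%N -> value ((a m).1 - (a n).1) <= (a n).2%:num - (a m).2%:num.
  elim: m => [|m IH]; first by rewrite leqn0 => /eqP ->;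
    rewrite !subrr (proj2 (value_eq0 0)).
  rewrite leq_eqVlt => /orP[/eqP ->|].
    by rewrite !subrr (proj2 (value_eq0 0)).
  rewrite ltnS => /IH h; have [d1 d2 _] := aP m.
  by apply: le_trans (value_sub_le d2 h) _; lra.
have small n : (a n).2%:num <= (2 ^+ n)^-1.
  elim: n => [|n IH] /=; first by rewrite expr0 invr1.
  have [d1 _ _] := aP n; apply: le_trans d1 _.
  by rewrite exprS invfM mulrC ler_pM2l // invr_gt0.
have ac : cauchy ((fun n => (a n).1) @ \oo).
  apply: cauchy_exP => e e0.
  have [n ne] : exists n, (2 ^+ n)^-1 < e.
    exists (Num.truncn e^-1).+1.
    rewrite -[ltRHS]invrK ltf_pV2 ?posrE ?invr_gt0 ?exprn_gt0 //.
    apply: lt_le_trans (truncnS_gt _) _.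
    by rewrite -natrX ler_nat; apply: ltnW; exact: ltn_expl.
  exists (a n).1; exists n => // m /= nm.
  rewrite ballEmdist /= mdist_value -valueN opprB.
  apply: le_lt_trans (nest _ _ nm) _.
  have am : 0 < (a m).2%:num by [].
  have := small n; lra.
have [l al] := Gc _ _ ac.
have ln n : value (l - (a n).1) <= (a n).2%:num.
  apply/ler_addgt0Pr => e e0.
  have [k _ kP] := al _ (nbhsx_ballx l e e0).
  have := kP (maxn k n) (leq_maxl _ _); rewrite /= ballEmdist /= mdist_value => h.
  rewrite [leRHS]addrC; apply: value_sub_le (ltW h) _.
  apply: le_trans (nest _ _ (leq_maxr k n)) _.
  have am : 0 < (a (maxn k n)).2%:num by [].
  lra.
have [C bC] := rep_bounded rhoP l.
have [_ _ /(_ l (ln _.+1))] := aP (Num.truncn C).+1.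
apply; apply: rep_bound_le bC; apply: ltW; exact: truncnS_gt.
Qed.

(** Choose [g] of value below [d] with [sqn (rho g v)] close to the supremum
    over that ball.  Nearby, [sqn (rho (g + h) v)] exceeds [sqn (rho g v)] by
    little while the inner product of the two vectors is close to
    [sqn (rho g v)], so they are close in norm; [rho (- g)], bounded by [C],
    moves this estimate to [0]. *)
Lemma rep_strongly_continuous (d C : R) : 0 < d -> 0 < C ->
  (forall g, value g < d -> rep_bound C g) ->
  forall v (e : R), 0 < e -> exists2 c : R, 0 < c &
    forall g, value g < c -> sqn (rho g v - v) <= e.
Proof.
move=> d0 C0 bC v e e0.
pose S : set R := [set sqn (rho g v) | g in [set g | value g < d]].
have S_sup : has_sup S.
  split; first by exists (sqn (rho 0 v)); exists 0 => //=; rewrite (proj2 (value_eq0 0)).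
  by exists (C * sqn v) => _ [g /= gd <-]; exact: bC.
have e1 : 0 < e / (2 * C) by rewrite divr_gt0 ?mulr_gt0.
set e' := e / (2 * C) in e1 *.
have [_ [g gd <-] gs] := sup_adherent e1 S_sup.
have [|c c0 cP] := rep_weak rhoP g v (rho g v) (e := e' / 2).
  by rewrite divr_gt0.
exists (Num.min c (d - value g)); first by rewrite lt_min c0 subr_gt0.
move=> h; rewrite lt_min => /andP[hc hd].
have hgS : sqn (rho (g + h) v) <= sup S.
  apply: sup_upper_bound => //; exists (g + h) => //=.
  by apply: le_lt_trans (valueD _ _) _; lra.
have : value (g + h - g) < c by rewrite addrAC subrr add0r.
move/cP; rewrite ltr_norml => /andP[hw _].
have close : sqn (rho (g + h) v - rho g v) <= 2 * e'.
  rewrite sqnB; move: hw; rewrite -/(sqn (rho g v)); lra.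
have -> : rho h v - v = rho (- g) (rho (g + h) v - rho g v).
  have linB a b : rho (- g) (a - b) = rho (- g) a - rho (- g) b.
    by have := rep_linear rhoP (- g) (-1) b a; rewrite !scaleN1r ![- _ + _]addrC.
  by rewrite linB -!(repD rhoP) addKr addNr (rep0 rhoP).
have bg : rep_bound C (- g) by apply: bC; rewrite valueN.
apply: le_trans (bg _) _; apply: le_trans (ler_wpM2l (ltW C0) close) _.
rewrite /e' le_eqVlt; apply/orP; left; apply/eqP; field.
by rewrite gt_eqF.
Qed.

End WeakRep.

(** Passing from the weak operator topology on [GL H] to matrix coefficients. *)
Lemma weak_rep_GL (R : realType) (H : hilbertType R) (G : valuedZmodType R)
    (pi : G -> GL H) :
  continuous pi ->
  (forall g h, GL_fun (pi (g + h)) = GL_fun (pi g) \o GL_fun (pi h)) ->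
  weak_rep (fun g => GL_fun (pi g)).
Proof.
move=> pi_cont piD.
have piP g : GL H (GL_fun (pi g)) by rewrite /GL_fun; exact: set_valP.
split.
- by move=> g; have [[]] := piP g.
- by move=> g h u; rewrite piD.
- move=> u; have [_ [S [_ Sl _]]] := piP 0.
  by apply: (can_inj Sl); rewrite -[LHS]/((GL_fun (pi 0) \o GL_fun (pi 0)) u) -piD addr0.
- move=> g; have [[lin bd] _] := piP g.
  pose L := HB.pack_for {linear H -> H} (GL_fun (pi g))
    (GRing.isLinear.Build R[i] H H _ _ lin).
  have /linear_boundedP /pinfty_ex_gt0 [M M0 bM] : bounded_near L (nbhs (0 : H)) by [].
  have M_real : M \is Num.real by rewrite realE ltW.
  exists ((complex.Re M) ^+ 2) => u; rewrite -lecR rmorphM rmorphXn /= !sqnE RRe_real //.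
  rewrite -exprMn; apply: lerXn2r; rewrite ?nnegrE ?mulr_ge0 //; first exact: ltW.
  exact: bM.
- move=> g u w e e0.
  have c1 : continuous (fun h => GL_fun (pi h) : wot H).
    move=> h; apply: (continuous_comp (pi_cont h)); exact: initial_continuous.
  pose f : G -> R[i]^o := fun h => inner (GL_fun (pi h)  u) w.
  have c2 : {for g, continuous f}.
    move/cvg_sup: (c1 g) => /(_ (fmap_filter _ _) (u, w)) c.
    have i := @initial_continuous (H -> H) R[i]^o
      (fun T : H -> H => inner (T u) w) (GL_fun (pi g)).
    move=> A /i iA; exact: (c (nbhs_filter g) _ iA).
  have eC : 0 < e%:C%C by rewrite ltcR.
  move/cvgrPdist_lt: c2 => /(_ _ eC) /nbhs_ballP[d /= d0 dP].
  exists d => // h hd.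
  have := dP h; rewrite ballEmdist /= mdist_value -valueN opprB => /(_ hd) fgh.
  rewrite distrC -ltcR; apply: le_lt_trans fgh.
  have -> : rdot (GL_fun (pi g) u) w - rdot (GL_fun (pi h) u) w =
      complex.Re (f g - f h) by rewrite raddfB.
  exact: normc_ge_Re.
Qed.

(** * Powers of a finite group valued by a pathological submeasure *)

Definition points (K : nat) := {s : {set 'I_K.*2} | (K <= #|s|)%N}.
HB.instance Definition _ K := Finite.on (points K).
Definition cube (K : nat) (A : finZmodType) := {ffun points K -> A}.
HB.instance Definition _ K A := GRing.Zmodule.on (cube K A).
HB.instance Definition _ K A := Finite.on (cube K A).

Definition diag K (A : finZmodType) (a : A) : cube K A := [ffun=> a].

Section CubeValue.
Context {R : realType} {G : valuedZmodType R} {A : finZmodType}.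
Variables (K : nat) (c : {additive A -> G}) (D d : R).
Hypothesis c_inj : injective c.
Hypotheses (D0 : 0 < D) (d0 : 0 < d).
Hypothesis cD : forall a, value (c a) <= D.
Hypothesis DdK : D <= d * K%:R.

(** [approx f (a, J)]: [f] is the constant [a] except on points lying in one of
    the blocks [J]. *)
Definition approx (f : cube K A) (p : A * {set 'I_K.*2}) : bool :=
  [forall i : points K, (f i == p.1) || ~~ [disjoint val i & p.2]].

Definition cost (p : A * {set 'I_K.*2}) : R := value (c p.1) + d * #|p.2|%:R.

(** The largest value that is bounded by [D], is at most [value (c a)] at the
    constant function [a], and is at most [d] on functions supported in one
    block. *)
Definition cvalue (f : cube K A) : R := \big[Order.min/D]_(p | approx f p) cost p.

Lemma cost_ge0 p : 0 <= cost p.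
Proof. by rewrite addr_ge0 ?value_ge0 // mulr_ge0 // ltW. Qed.

Lemma cvalue_leD f : cvalue f <= D.
Proof. exact: bigmin_le_id. Qed.

Lemma cvalue_le f p : approx f p -> cvalue f <= cost p.
Proof. by move=> fp; exact: bigmin_le_cond. Qed.

Lemma cvalueP f : cvalue f = D \/ exists2 p, approx f p & cvalue f = cost p.
Proof.
rewrite /cvalue; elim/big_ind: _ => [|x y [->|[p fp ->]] [->|[q fq ->]]|p fp].
- by left.
- by left; rewrite minxx.
- by case: (leP D (cost q)) => _; [left|right; exists q].
- by case: (leP (cost p) D) => _; [right; exists p|left].
- by case: (leP (cost p) (cost q)) => _; right; [exists p|exists q].
- by right; exists p.
Qed.

Lemma approxN f p : approx f p -> approx (- f) (- p.1, p.2).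
Proof. by move=> /forallP fp; apply/forallP => i; rewrite ffunE eqr_opp; exact: fp. Qed.

Lemma approxD f g p q : approx f p -> approx g q ->
  approx (f + g) (p.1 + q.1, p.2 :|: q.2)%SET.
Proof.
move=> /forallP fp /forallP gq; apply/forallP => i; rewrite ffunE /=.
have [/eqP fi|] := boolP (f i == p.1); last first.
  move=> nf; have := fp i; rewrite (negbTE nf) /= => h; apply/orP; right.
  apply: contra h; apply: disjointWr; exact: finset.subsetUl.
have [/eqP gi|] := boolP (g i == q.1); last first.
  move=> ng; have := gq i; rewrite (negbTE ng) /= => h; apply/orP; right.
  apply: contra h; apply: disjointWr; exact: finset.subsetUr.
by rewrite fi gi eqxx.
Qed.

Lemma cvalue_ge0 f : 0 <= cvalue f.
Proof. by case: (cvalueP f) => [->|[p _ ->]]; [exact: ltW|exact: cost_ge0]. Qed.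

(** Approximating the constant [a] by another constant needs blocks that cover
    all points, hence more than [K] of them, and that costs more than [D]. *)
Lemma cvalue_diag a : cvalue (diag K a) = value (c a).
Proof.
apply/eqP; rewrite eq_le; apply/andP; split.
  have /cvalue_le : approx (diag K a) (a, finset.set0).
    by apply/forallP => i; rewrite ffunE eqxx.
  by rewrite /cost /= cards0 mulr0 addr0.
apply/bigmin_geP; split=> // -[b J] /forallP ab; rewrite /cost /=.
have [->|nab] := eqVneq a b; first by rewrite lerDl mulr_ge0 // ltW.
apply: le_trans (cD a) _; apply: le_trans DdK _.
apply: ler_wpDl; first exact: value_ge0.
rewrite ler_pM2l // ler_nat leqNgt; apply/negP => JK.
(* Otherwise the complement of [J] is a point that no block of [J] contains. *)
have KJ : (K <= #|~: J|)%N.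
  by have := cardsC J; rewrite card_ord; move: #|J| #|~: J| JK => s t; lia.
have := ab (exist _ (~: J)%SET KJ).
rewrite ffunE (negbTE nab) /= => /negP; apply.
by rewrite -setI_eq0 finset.setIC finset.setICr.
Qed.

Lemma cvalue_eq0 f : cvalue f = 0 <-> f = 0.
Proof.
split=> [f0|->]; last first.
  have -> : 0 = diag K (0 : A) by apply/ffunP => i; rewrite !ffunE.
  by rewrite cvalue_diag raddf0; apply/value_eq0.
case: (cvalueP f) => [fD|[[a J] /forallP fp]].
  by move: D0; rewrite -fD f0 ltxx.
rewrite f0 => /esym/eqP; rewrite paddr_eq0 ?value_ge0 ?mulr_ge0 ?(ltW d0) //=.
rewrite mulf_eq0 (gt_eqF d0) /= pnatr_eq0 cards_eq0 => /andP[/eqP a0 /eqP J0].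
have {}a0 : a = 0 by apply: c_inj; rewrite raddf0; apply/value_eq0.
apply/ffunP => i; have := fp i; rewrite /= J0 a0 ffunE => /orP[/eqP //|].
by rewrite disjoint_sym -setI_eq0 finset.set0I eqxx.
Qed.

Lemma cvalueN f : cvalue (- f) = cvalue f.
Proof.
suff le g : cvalue (- g) <= cvalue g.
  by apply/eqP; rewrite eq_le le -{1}[f]opprK le.
case: (cvalueP g) => [->|[p /approxN/cvalue_le gp ->]]; first exact: cvalue_leD.
by move: gp; rewrite /cost /= raddfN valueN.
Qed.

Lemma cvalueD f g : cvalue (f + g) <= cvalue f + cvalue g.
Proof.
case: (cvalueP f) => [->|[p fp ->]].
  by apply: le_trans (cvalue_leD _) _; rewrite lerDl cvalue_ge0.
case: (cvalueP g) => [->|[q gq ->]].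
  by apply: le_trans (cvalue_leD _) _; rewrite lerDr cost_ge0.
apply: le_trans (cvalue_le (approxD fp gq)) _; rewrite /cost /= raddfD.
rewrite addrACA lerD ?valueD // -mulrDr ler_pM2l // -natrD ler_nat.
by rewrite cardsU leq_subr.
Qed.

Lemma cvalue_supp (f : cube K A) j : (forall i : points K, j \notin val i -> f i = 0) ->
  cvalue f <= d.
Proof.
move=> fj; have /cvalue_le : approx f (0, [set j]%SET).
  apply/forallP => i; case: (boolP (j \in val i)) => ji; last by rewrite fj ?eqxx.
  apply/orP; right; apply/negP => /disjointFr -/(_ _ ji).
  by rewrite finset.inE eqxx.
by rewrite /cost /= raddf0 (proj2 (value_eq0 0)) // add0r cards1 mulr1.
Qed.

Definition valued_cube : valuedZmodType R :=
  HB.pack_for (valuedZmodType R) (cube K A)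
    (isValued.Build R (cube K A) cvalue_ge0 cvalue_eq0 cvalueN cvalueD).

Lemma valued_cube_class (r : \bar R) N : (D%:E <= r)%E ->
  (forall x : G, x *+ N = 0) -> in_classG r N valued_cube.
Proof.
move=> Dr GN; split.
- exists setT; last by move=> O [x Ox] _; exists x.
  by apply: finite_set_countable; exact: (@finite_finset (cube K A)).
- move=> f; apply/cvgrPdist_lt => e e0.
  exists (Num.truncn (D / e)).+1 => // n /= nD.
  have n0 : 0 < n%:R :> R by rewrite ltr0n; apply: leq_trans nD.
  rewrite sub0r normrN ger0_norm ?divr_ge0 ?value_ge0 // ltr_pdivrMr //.
  apply: le_lt_trans (cvalue_leD _) _; rewrite mulrC -ltr_pdivrMr //.
  apply: lt_le_trans (truncnS_gt _) _; by rewrite ler_nat.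
- by move=> f; apply: le_trans Dr; rewrite lee_fin; exact: cvalue_leD.
- move=> f; apply/ffunP => i; rewrite ffunMnE ffunE.
  by apply: c_inj; rewrite raddfMn raddf0 GN.
Qed.

End CubeValue.

Lemma finite_subgroup_range (A : finZmodType) (G : zmodType) (e : A -> G) :
  {morph e : a b / a - b} -> finite_subgroup (range e).
Proof.
move=> eB; split.
  by apply: finite_image; exact: finite_finset.
split=> [|_ _ /set_mem[a _ <-] /set_mem[b _ <-]].
  by rewrite inE; exists 0 => //; rewrite -(subrr 0) eB subrr.
by rewrite inE; exists (a - b).
Qed.

(** Some copy of the valued power exists in [G] because the group contains all
    finite groups of its class; homogeneity moves its diagonal onto the given
    copy [c] of [A]. *)
Lemma cube_extension (R : realType) (r : \bar R) (N : nat) (G : valuedZmodType R)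
    (A : finZmodType) (K : nat) (c : {additive A -> G}) (D d : R) :
  isG r N G -> injective c -> 0 < D -> 0 < d -> (D%:E <= r)%E ->
  (forall a, value (c a) <= D) -> D <= d * K%:R ->
  exists iota : {additive cube K A -> G},
    [/\ injective iota, forall a, iota (diag K a) = c a,
        forall f, value (iota f) <= D &
        forall (f : cube K A) j, (forall i : points K, j \notin val i -> f i = 0) ->
          value (iota f) <= d].
Proof.
move=> hG c_inj D0 d0 Dr cD DdK.
pose F := valued_cube c_inj D0 d0 cD DdK.
have [_ _ _ GN] := isG_class hG.
have [j jP] : exists j : {additive F -> G}, isometric j.
  apply: (isG_embeds hG) (valued_cube_class c_inj D0 d0 cD DdK Dr GN).
  exact: (@finite_finset (cube K A)).
pose e (a : A) : G := j (diag K a).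
have eB a b : e (a - b) = e a - e b.
  by rewrite /e -raddfB; congr (j _); apply/ffunP => i; rewrite !ffunE.
have ev a : value (e a) = value (c a).
  by rewrite /e jP; exact: cvalue_diag.
have e_inj : injective e.
  move=> a b ab; apply/eqP; rewrite -subr_eq0; apply/eqP/c_inj.
  rewrite raddf0; apply/value_eq0; rewrite -ev eB ab subrr; exact/value_eq0.
have xgetE a : xget 0 [set b | e b = e a] = a.
  apply: e_inj; exact: (@xgetPex _ 0 [set b | e b = e a] (ex_intro _ a erefl)).
have [|||||g [giso _ ge]] := isG_homogeneous hG (A := range e) (B := range c)
  (f := fun y => c (xget 0 [set a | e a = y])).
- exact: finite_subgroup_range.
- by apply: finite_subgroup_range => a b; rewrite raddfB.
- by move=> _ [a _ <-]; rewrite xgetE; exists a.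
- move=> _ _ /set_mem[a _ <-] /set_mem[b _ <-].
  have -> : e a + e b = e (a + b).
    by apply/eqP; rewrite eq_sym -subr_eq -eB addrK.
  by rewrite !xgetE raddfD.
- by move=> _ /set_mem[a _ <-]; rewrite xgetE ev.
pose h (f : cube K A) : G := g (j f).
have hB : zmod_morphism h by move=> f f'; rewrite /h !raddfB.
have hv f : value (h f) = cvalue c D d f by rewrite /h giso jP.
exists (HB.pack_for {additive cube K A -> G} h (GRing.isZmodMorphism.Build _ _ h hB)).
split=> /=.
- move=> f f' /eqP; rewrite -subr_eq0 -hB => /eqP /(value_eq0 _).2.
  by rewrite hv => /(cvalue_eq0 c_inj D0 d0 cD DdK) /eqP; rewrite subr_eq0 => /eqP.
- by move=> a; rewrite /h -/(e a) ge ?xgetE // inE; exists a.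
- by move=> f; rewrite hv; exact: cvalue_leD.
- by move=> f i fi; rewrite hv; exact: cvalue_supp fi.
Qed.

(** * Triviality of the representation *)

Definition single K (A : finZmodType) (i : points K) (a : A) : cube K A :=
  [ffun k => if k == i then a else 0].

Section Cube.
Context {K : nat} {A : finZmodType}.

Lemma singleB (i : points K) (a b : A) : single i (a - b) = single i a - single i b.
Proof.
by apply/ffunP => k; rewrite !ffunE; case: eqP; rewrite ?subr0.
Qed.

Lemma cube_sum (f : cube K A) : f = \sum_i single i (f i).
Proof.
apply/ffunP => k; rewrite sum_ffunE (bigD1 k) //= ffunE eqxx.
by rewrite big1 ?addr0 // => i ik; rewrite ffunE eq_sym (negbTE ik).
Qed.

Definition axis (i : points K) : {set cube K A} := [set single i a | a : A]%SET.

Definition slab (j : 'I_K.*2) : {set cube K A} :=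
  [set f : cube K A | [forall i : points K, (j \notin val i) ==> (f i == 0)]]%SET.

Lemma slabP j (f : cube K A) :
  reflect (forall i : points K, j \notin val i -> f i = 0) (f \in slab j).
Proof.
rewrite finset.inE; apply: (iffP forallP) => fj i.
  by move=> ji; apply/eqP; have := fj i; rewrite ji.
by apply/implyP => ji; apply/eqP; exact: fj.
Qed.

Lemma axis_zmod_closed i : zmod_closed (axis i).
Proof.
split=> [|_ _ /imsetP[a _ ->] /imsetP[b _ ->]]; last first.
  by rewrite -singleB; apply: imset_f.
by apply/imsetP; exists 0 => //; rewrite -[in RHS](subrr 0) singleB subrr.
Qed.

Lemma slab_zmod_closed j : zmod_closed (slab j).
Proof.
split=> [|f g /slabP fj /slabP gj]; apply/slabP => i ji; rewrite !ffunE //.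
by rewrite fj // gj // subr0.
Qed.

Lemma axis_sub_slab (i : points K) (j : 'I_K.*2) : j \in val i -> axis i \subset slab j.
Proof.
move=> ji; apply/fintype.subsetP => _ /imsetP[a _ ->]; apply/slabP => k jk.
by rewrite ffunE; case: eqP => // ki; rewrite ki ji in jk.
Qed.

(** The half-covering property: [axis i] lies in [slab j] as soon as [j] belongs
    to the point [i], which has at least [K] of the [2K] elements. *)
Lemma card_axis_sub_slab (i : points K) : (K <= #|[pred j | axis i \subset slab j]|)%N.
Proof.
apply: leq_trans (valP i) _; apply: subset_leq_card.
by apply/fintype.subsetP => j ji; rewrite inE axis_sub_slab.
Qed.

End Cube.

Section Trivial.
Context {R : realType} {H : hilbertType R} {G : valuedZmodType R}.
Variables (r : \bar R) (N : nat) (rho : G -> H -> H).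
Hypotheses (hG : isG r N G) (rhoP : weak_rep rho).

Lemma rep_sum_fixed (I : finType) (g : I -> G) v :
  (forall i, rho (g i) v = v) -> rho (\sum_i g i) v = v.
Proof.
move=> gv; elim/big_ind: _ => [|x y xv yv|//]; first exact: rep0.
by rewrite (repD rhoP) yv.
Qed.

(** All powers of [A] embedded over [c] with bound [D] stay in the region where
    the operators are bounded by [C], so [almost_fixed] applies with any [e]. *)
Lemma small_rep_trivial (A : finZmodType) (c : {additive A -> G}) (D d C : R) :
  injective c -> 0 < C -> (forall g, value g < d -> rep_bound rho C g) ->
  0 < D -> D < d -> (D%:E <= r)%E -> (forall a, value (c a) <= D) ->
  forall a v, rho (c a) v = v.
Proof.
move=> c_inj C0 bC D0 Dd Dr cD a v.
suff sm e : 0 < e -> sqn (rho (c a) v - v) <= 4 * (C + 1) * C ^+ 2 * e.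
  apply/eqP; rewrite -subr_eq0; apply/eqP/sqn_eq0/eqP.
  rewrite eq_le sqn_ge0 andbT; apply/ler_addgt0Pr => e e0; rewrite add0r.
  have M0 : 0 < 4 * (C + 1) * C ^+ 2 by rewrite !mulr_gt0 ?exprn_gt0 // addr_gt0.
  apply: le_trans (sm (e / (4 * (C + 1) * C ^+ 2)) _) _; first by rewrite divr_gt0.
  by rewrite mulrC divfK // gt_eqF.
move=> e0.
have [|e' e'0 e'P] := rep_strongly_continuous rhoP (d := d) _ C0 bC v e0.
  exact: lt_trans Dd.
pose s := e' / 2.
have s0 : 0 < s by rewrite divr_gt0.
pose K := (Num.truncn (D / s)).+1.
have DsK : D <= s * K%:R.
  by rewrite mulrC -ler_pdivrMr //; apply: ltW; exact: truncnS_gt.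
have [iota [_ iota_diag iotaD iota_supp]] :=
  cube_extension hG c_inj D0 s0 Dr cD DsK.
rewrite -iota_diag.
apply: (@almost_fixed R H (cube K A) (fun f => rho (iota f)) _ _ _
  (points K) 'I_K.*2 axis slab K C e v) => //.
- by move=> f; exact: rep_linear.
- by move=> f f' u; rewrite raddfD (repD rhoP).
- by move=> u; rewrite raddf0 (rep0 rhoP).
- exact: ltW.
- exact: axis_zmod_closed.
- exact: slab_zmod_closed.
- move=> u fu f _; rewrite (cube_sum f) raddf_sum; apply: rep_sum_fixed => i.
  by apply: (fu i); exact: imset_f.
- exact: card_axis_sub_slab.
- by rewrite card_ord.
- by move=> f u; apply: bC; exact: le_lt_trans (iotaD f) Dd.
- move=> j f /slabP fj; apply: e'P; apply: le_lt_trans (iota_supp _ _ fj) _.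
  by rewrite /s ltr_pdivrMr // mulr_natr mulr2n ltrDl.
Qed.

(** In a power of [A] embedded over [c], an element of the diagonal is a sum of
    elements of coordinate subgroups.  Each coordinate lies in some block, so the
    values on its subgroup are small and [small_rep_trivial] applies to it. *)
Lemma finite_rep_trivial (A : finZmodType) (c : {additive A -> G}) (D d C : R) :
  injective c -> 0 < d -> 0 < C -> (forall g, value g < d -> rep_bound rho C g) ->
  0 < D -> (D%:E <= r)%E -> (forall a, value (c a) <= D) ->
  forall a v, rho (c a) v = v.
Proof.
move=> c_inj d0 C0 bC D0 Dr cD a v.
pose s := Num.min D (d / 2).
have s0 : 0 < s by rewrite lt_min D0 divr_gt0.
have sd : s < d by rewrite gt_min ltr_pdivrMr // mulr_natr mulr2n ltrDl d0 orbT.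
have sr : (s%:E <= r)%E by apply: le_trans Dr; rewrite lee_fin ge_min lexx.
pose K := (Num.truncn (D / s)).+1.
have DsK : D <= s * K%:R.
  by rewrite mulrC -ler_pdivrMr //; apply: ltW; exact: truncnS_gt.
have [iota [iota_inj iota_diag iotaD iota_supp]] :=
  cube_extension hG c_inj D0 s0 Dr cD DsK.
rewrite -iota_diag (cube_sum (diag K a)) raddf_sum; apply: rep_sum_fixed => i.
pose ci b := iota (single i b).
have ciB : zmod_morphism ci by move=> b b'; rewrite /ci singleB raddfB.
pose ci' := HB.pack_for {additive A -> G} ci (GRing.isZmodMorphism.Build _ _ ci ciB).
apply: (@small_rep_trivial _ ci' s d C) => //.
- by move=> b b' /iota_inj /ffunP /(_ i); rewrite !ffunE eqxx.
- move=> b; have /card_gt0P[j ji] : (0 < #|val i|)%N by apply: leq_trans (valP i).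
  apply: (iota_supp _ j); apply/slabP.
  by apply: (fintype.subsetP (axis_sub_slab ji)); exact: imset_f.
Qed.

End Trivial.

Lemma torsion_cyclic (G : zmodType) (x : G) : torsion x ->
  exists (A : finZmodType) (c : {additive A -> G}), injective c /\ exists a, c a = x.
Proof.
case=> n n0 xn0.
have ex : exists m, (0 < m)%N && (x *+ m == 0) by exists n; rewrite n0 xn0 eqxx.
case: (ex_minnP ex) => -[//|m] /andP[_ /eqP xm] minm.
pose c (k : 'I_m.+1) := x *+ k.
have cmod k : x *+ (k %% m.+1) = x *+ k.
  by rewrite [in RHS](divn_eq k m.+1) mulrnDr mulnC mulrnA xm mul0rn add0r.
have cD k l : c (k + l) = c k + c l by rewrite /c /= cmod mulrnDr.
have cB : zmod_morphism c.
  by move=> k l; apply/eqP; rewrite eq_sym subr_eq -cD subrK.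
exists 'I_m.+1.
exists (HB.pack_for {additive 'I_m.+1 -> G} c (GRing.isZmodMorphism.Build _ _ c cB)).
split=> /=; last by exists (inZp 1 : 'I_m.+1); rewrite /c /= cmod.
move=> k l /eqP; rewrite -subr_eq0 -cB => /eqP kl0.
apply/eqP; rewrite -subr_eq0; move: kl0; set z := k - l => z0.
apply/eqP/val_inj; apply/eqP; rewrite -leqn0 leqNgt; apply/negP => zgt0.
have := minm z; rewrite zgt0 -/(c z) z0 eqxx => /(_ isT).
by rewrite leqNgt ltn_ord.
Qed.

Theorem theorem4p5 (R : realType) (r : \bar R) (N : nat)
    (hr : r = 1%E \/ r = +oo%E) (hN : N != 1%N)
    (G : valuedZmodType R) (hG : isG r N G) :
  strongly_exotic R G.
Proof.
move=> H pi pi_cont piD.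
have rhoP := weak_rep_GL pi_cont piD.
have [d [C [d0 C0 bC]]] := rep_locally_bounded rhoP (isG_complete hG).
have [_ _ Gr GN] := isG_class hG.
have tors x v : torsion x -> GL_fun (pi x) v = v.
  move=> /torsion_cyclic[A [c [c_inj [a <-]]]].
  have [D [D0 Dr cD]] : exists D : R,
      [/\ 0 < D, (D%:E <= r)%E & forall b, value (c b) <= D].
    case: hr => hr.
      exists 1; split; rewrite ?hr // => b.
      by rewrite -lee_fin -[leRHS]/1%E -hr; exact: Gr.
    exists (1 + \sum_b value (c b)); split.
    - by rewrite ltr_pwDl // sumr_ge0 // => b _; exact: value_ge0.
    - by rewrite hr leey.
    - move=> b; rewrite (bigD1 b) //= addrCA lerDl addr_ge0 // sumr_ge0 // => b' _.
      exact: value_ge0.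
  exact: (finite_rep_trivial hG rhoP c_inj d0 C0 bC D0 Dr cD).
have tdense : dense (@torsion G).
  case: (posnP N) => [|N0]; first exact: isG_dense_torsion hG.
  by move=> O [x Ox] _; exists x; split => //; exists N.
have triv x v : GL_fun (pi x) v = v.
  apply/eqP; rewrite -subr_eq0; apply/eqP/sqn_eq0/eqP.
  rewrite eq_le sqn_ge0 andbT; apply/ler_addgt0Pr => e e0; rewrite add0r.
  have [e' e'0 e'P] := rep_strongly_continuous rhoP d0 C0 bC v e0.
  have [t [/interior_subset xt tt]] : (ball x e')° `&` @torsion G !=set0.
    by apply: tdense; [exists x; exact: nbhsx_ballx|exact: open_interior].
  have -> : x = t + (x - t) by rewrite addrC subrK.
  rewrite piD /= tors //; apply: e'P.
  by move: xt; rewrite ballEmdist /= mdist_value.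
move=> g h; apply: val_inj; apply/funext => v.
exact: etrans (triv g v) (esym (triv h v)).
Qed.
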